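(* Let $0<\alpha_2<\alpha_1<1$, $\lambda>0$, $C_1\ge0$, $C_2\ge0$ with $C_1+C_2=1$. Let $\{N^{\alpha_1,\alpha_2}(t)\}_{t\ge0}$ be the mixed fractional Poisson process, and let $C^{\alpha_1,\alpha_2}(t)=\sum_{i=1}^{N^{\alpha_1,\alpha_2}(t)}X_i$ be the compound mixed fractional Poisson process, where $\{X_i\}_{i\ge1}$ are iid positive integer valued random variables with finite mean, independent of $\{N^{\alpha_1,\alpha_2}(t)\}_{t\ge0}$. Then both processes exhibit overdispersion, i.e. for all $t>0$, $$\operatorname{Var}\left(N^{\alpha_1,\alpha_2}(t)\right)-\mathbb{E}\left(N^{\alpha_1,\alpha_2}(t)\right)>0\quad\text{and}\quad \operatorname{Var}\left(C^{\alpha_1,\alpha_2}(t)\right)-\mathbb{E}\left(C^{\alpha_1,\alpha_2}(t)\right)>0.$$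
   Context: The mixed stable subordinator $\{D_{\alpha_1,\alpha_2}(t)\}_{t\ge0}$ is the subordinator (non-decreasing L\'evy process) with $\mathbb{E}(e^{-sD_{\alpha_1,\alpha_2}(t)})=e^{-t(C_1s^{\alpha_1}+C_2s^{\alpha_2})}$, $s\ge0$. Its inverse is $Y_{\alpha_1,\alpha_2}(t)=\inf\{s\ge0:D_{\alpha_1,\alpha_2}(s)>t\}$. The mixed fractional Poisson process (MFPP) is $N^{\alpha_1,\alpha_2}(t)=N(Y_{\alpha_1,\alpha_2}(t))$, where $\{N(t)\}_{t\ge0}$ is a homogeneous Poisson process with intensity $\lambda$ independent of $\{Y_{\alpha_1,\alpha_2}(t)\}_{t\ge0}$. Variances take values in $[0,\infty]$. *)

(* Defs.v *)
From HB Require Import structures.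
From mathcomp Require Import all_boot all_order all_algebra.
From mathcomp Require Import all_classical all_reals all_analysis.
Set Implicit Arguments.
Unset Strict Implicit.
Unset Printing Implicit Defensive.
Import Order.TTheory GRing.Theory Num.Theory.
Import numFieldNormedType.Exports.
Local Open Scope classical_set_scope.
Local Open Scope ring_scope.

(* The independence of Z 0, ..., Z n.-1. The product rule for a subfamily is
   obtained by taking A i to be the full set for the other indices. *)
Definition mutually_independent d d' (T : measurableType d)
    (U : measurableType d') (R : realType) (P : probability T R)
    (n : nat) (Z : nat -> T -> U) : Prop :=
  forall A : nat -> set U, (forall i, measurable (A i)) ->
    P (\bigcap_(i < n) (Z i @^-1` A i)) = (\prod_(i < n) P (Z i @^-1` A i))%E.

(* The sigma-algebra generated by the family Z i, i in J. *)
Definition sigma_of d' (T : Type) (U : measurableType d') (I : Type)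
    (J : set I) (Z : I -> T -> U) : set (set T) :=
  <<s \bigcup_(i in J) preimage_set_system setT (Z i) measurable >>.

Definition independent_systems d (T : measurableType d) (R : realType)
    (P : probability T R) (F G : set (set T)) : Prop :=
  forall A B, F A -> G B -> P (A `&` B) = (P A * P B)%E.

(* Processes are indexed by R; only times t >= 0 are meaningful. *)
Definition cadlag (R : realType) (f : R -> R) : Prop :=
  (forall t : R, 0 <= t -> f x @[x --> t^'+] --> f t) /\
  (forall t : R, 0 < t -> cvg (f x @[x --> t^'-])).

Record levy_process d (T : measurableType d) (R : realType)
    (P : probability T R) (Z : R -> T -> R) : Prop := LevyProcess {
  levy_measurable : forall t : R, 0 <= t -> measurable_fun setT (Z t) ;
  levy_start : {ae P, forall w, Z 0 w = 0} ;
  levy_independent : forall (n : nat) (t : nat -> R),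
    0 <= t 0%N -> {homo t : i j / (i <= j)%N >-> i <= j} ->
    mutually_independent P n (fun i w => Z (t i.+1) w - Z (t i) w) ;
  levy_stationary : forall s h : R, 0 <= s -> 0 <= h ->
    forall B : set R, measurable B ->
    P [set w | B (Z (s + h) w - Z s w)] = P [set w | B (Z h w)] ;
  levy_cadlag : {ae P, forall w, cadlag (Z ^~ w)} }.

Definition subordinator d (T : measurableType d) (R : realType)
    (P : probability T R) (D : R -> T -> R) : Prop :=
  levy_process P D /\
  {ae P, forall w, forall s t : R, 0 <= s -> s <= t -> D s w <= D t w}.

Definition mixed_stable_subordinator d (T : measurableType d) (R : realType)
    (P : probability T R) (a1 a2 C1 C2 : R) (D : R -> T -> R) : Prop :=
  subordinator P D /\
  forall t s : R, 0 <= t -> 0 <= s ->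
    'E_P[fun w => expR (- (s * D t w))]%E =
      (expR (- (t * (C1 * s `^ a1 + C2 * s `^ a2))))%:E.

(* The infimum in R is 0 on the empty set; when D is a mixed stable subordinator
   with C1 + C2 = 1, the set below is almost surely nonempty. *)
Definition first_passage (T : Type) (R : realType) (D : R -> T -> R)
    (t : R) (w : T) : R :=
  inf [set s | 0 <= s /\ t < D s w].

(* poisson_pmf is the Poisson mass function only for a positive rate, hence the
   condition 0 < t; at time 0 the process is null by levy_start. *)
Definition poisson_process d (T : measurableType d) (R : realType)
    (P : probability T R) (lambda : R) (N : R -> T -> nat) : Prop :=
  levy_process P (fun t w => (N t w)%:R) /\
  forall (t : R) (k : nat), 0 < t ->
    P [set w | N t w = k] = (poisson_pmf (lambda * t) k)%:E.

(* M t = N (Y t), Y being the inverse of D. Since paths are cadlag only almost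
   surely, measurability of Y t and M t is not automatic and is part of the
   requirement that Y and M be stochastic processes. *)
Definition mixed_fractional_poisson d (T : measurableType d) (R : realType)
    (P : probability T R) (a1 a2 C1 C2 lambda : R)
    (M : R -> {RV P >-> nat}) : Prop :=
  exists (D : R -> T -> R) (Y : R -> {RV P >-> R}) (N : R -> T -> nat),
    [/\ mixed_stable_subordinator P a1 a2 C1 C2 D,
        forall (t : R) (w : T), 0 <= t -> Y t w = first_passage D t w,
        poisson_process P lambda N,
        independent_systems P (sigma_of [set t | 0 <= t] N)
                              (sigma_of [set t | 0 <= t] Y) &
        forall (t : R) (w : T), 0 <= t -> M t w = N (Y t w) w].

Definition iid d d' (T : measurableType d) (U : measurableType d')
    (R : realType) (P : probability T R) (X : nat -> {RV P >-> U}) : Prop :=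
  (forall n, mutually_independent P n X) /\
  (forall i (B : set U), measurable B ->
    distribution P (X i) B = distribution P (X 0%N) B).

(* X i is the jump X_{i+1} of the usual indexing from 1. *)
Definition compound (T : Type) (R : realType) (X : nat -> T -> nat)
    (M : R -> T -> nat) (t : R) (w : T) : nat :=
  (\sum_(i < M t w) X i w)%N.

(* Main.v *)
(* Write N(Y) for the mixed fractional Poisson process M at time t. Conditioning
   on Y gives P(M = k) = E[pois_k(lambda Y)], so the factorial moments are
   E[M] = lambda E[Y] and E[M(M-1)] = lambda^2 E[Y^2], and for a counting
   variable Z with finite mean, Var Z > E Z amounts to E[Z(Z-1)] > (E Z)^2.
   For M this is Var Y > 0. The Chernoff bound
   P(Y > s) <= P(D_s <= t) <= e^(t - s) shows that E[Y] is finite, and Y is not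
   constant: with phi(th) = C1 th^a1 + C2 th^a2 the Laplace exponent of D,
   phi(th)/th tends to infinity at 0, which makes P(Y <= s) > 0 for
   every s > 0, while P(Y > 0) > 0. For the compound process the off-diagonal
   terms alone give E[C(C-1)] >= E[X]^2 E[M(M-1)] > (E[X] E[M])^2 = (E C)^2. *)
Require Import Defs.
From HB Require Import structures.
From mathcomp Require Import all_boot all_order all_algebra.
From mathcomp Require Import all_classical all_reals all_analysis.
From mathcomp Require Import measurable_realfun ring lra.
Set Implicit Arguments.
Unset Strict Implicit.
Unset Printing Implicit Defensive.
Import Order.TTheory GRing.Theory Num.Theory.
Import numFieldNormedType.Exports.
Local Open Scope classical_set_scope.
Local Open Scope ring_scope.

(** * Natural-number-valued random variables: measurability and integrals by cases *)

(** The values of [U] are countably many, so a preimage splits along the events [U = k]. This serves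
    for random indices: a process at a discretised time, a sum with a random number of terms. *)
Lemma measurable_fun_natcase d d' (T : measurableType d) (V : measurableType d')
    (U : T -> nat) (g : nat -> T -> V) :
  measurable_fun setT U -> (forall k, measurable_fun setT (g k)) ->
  measurable_fun setT (fun w => g (U w) w).
Proof.
move=> mU mg _ A mA; rewrite setTI.
rewrite (_ : _ @^-1` A =
  \bigcup_k (U @^-1` [set k] `&` g k @^-1` A)); last first.
  apply/seteqP; split => [w Aw|w [k _ [/= -> //]]].
  by exists (U w).
apply: bigcupT_measurable => k; apply: measurableI.
  by rewrite -[X in measurable X]setTI; exact: mU.
by rewrite -[X in measurable X]setTI; exact: mg.
Qed.

Lemma measurable_fun_fromnat d' (V : measurableType d') (f : nat -> V) :
  measurable_fun setT f.
Proof. by []. Qed.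

Lemma measurable_nat_preimage d (T : measurableType d) (U : T -> nat)
    (A : set nat) : measurable_fun setT U -> measurable (U @^-1` A).
Proof. by move=> mU; rewrite -[X in measurable X]setTI; exact: mU. Qed.

(** Singletons [k%:R] are Borel. This brings back to [nat] the measurability that [levy_process] and
    finite sums provide in [R]. *)
Lemma measurable_fun_natr d (T : measurableType d) (R : realType)
    (U : T -> nat) : measurable_fun setT (fun w => (U w)%:R : R) ->
  measurable_fun setT U.
Proof.
move=> mU _ A _; rewrite setTI.
rewrite (_ : U @^-1` A = \bigcup_(k in A) (fun w => (U w)%:R : R) @^-1` [set k%:R]).
  apply: bigcup_measurable => k _.
  by rewrite -[X in measurable X]setTI; apply: mU => //; exact: measurable_set1.
apply/seteqP; split => [w Aw|w [k Ak /= /eqP]].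
  by exists (U w).
by rewrite eqr_nat => /eqP ->.
Qed.

Lemma integral_natcase d (T : measurableType d) (R : realType)
    (P : {measure set T -> \bar R}) (D : set T) (U : T -> nat)
    (g : nat -> T -> \bar R) :
  measurable D -> measurable_fun setT U ->
  (forall k, measurable_fun setT (g k)) -> (forall k w, (0 <= g k w)%E) ->
  (\int[P]_(w in D) g (U w) w =
    \sum_(k <oo) \int[P]_(w in D `&` U @^-1` [set k]) g k w)%E.
Proof.
move=> mD mU mg g0.
have DE : D = \bigcup_k (D `&` U @^-1` [set k]).
  apply/seteqP; split => [w Dw|w [k _ []//]].
  by exists (U w).
rewrite [in LHS]DE ge0_integral_bigcup//.
- apply: eq_eseriesr => k _; apply: eq_integral => w.
  by rewrite inE => -[_ /= ->].
- by move=> k; apply: measurableI => //; exact: measurable_nat_preimage.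
- by apply: (measurable_funS measurableT) => //; exact: measurable_fun_natcase.
- apply/trivIsetP => i j _ _ ij; apply/seteqP; split => // w [[_ /= wi] [_ /= wj]].
  by move: ij; rewrite -wi wj eqxx.
Qed.

Lemma integral_nat_comp d (T : measurableType d) (R : realType)
    (P : {measure set T -> \bar R}) (D : set T) (U : T -> nat)
    (f : nat -> \bar R) :
  measurable D -> measurable_fun setT U -> (forall k, (0 <= f k)%E) ->
  (\int[P]_(w in D) f (U w) =
    \sum_(k <oo) f k * P (D `&` U @^-1` [set k]))%E.
Proof.
move=> mD mU f0; rewrite (@integral_natcase _ _ _ _ _ _ (fun k _ => f k))//.
apply: eq_eseriesr => k _; rewrite (integral_cst P)//.
by apply: measurableI => //; exact: measurable_nat_preimage.
Qed.

Lemma measurable_fun_natrE d (T : measurableType d) (R : realType)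
    (U : T -> nat) : measurable_fun setT U ->
  measurable_fun setT (fun w => (U w)%:R%:E : \bar R).
Proof.
by move=> mU; exact: (@measurable_fun_natcase _ _ _ _ U (fun k _ => k%:R%:E)).
Qed.

(** The factor [x] may be infinite here: the series is read as an integral against the counting
    measure. *)
Lemma nneseriesZl_ereal (R : realType) (f : nat -> \bar R) (x : \bar R) :
  (0 <= x)%E -> (forall i, (0 <= f i)%E) ->
  (\sum_(i <oo) (x * f i) = x * \sum_(i <oo) f i)%E.
Proof.
move=> x0 f0.
have f1 i (_ : true) : (0 <= f i)%E by [].
have := @ge0_integralZl _ _ R counting setT measurableT f (measurable_fun_fromnat f) x.
by rewrite !ge0_integral_count//; [apply|move=> i; rewrite mule_ge0].
Qed.

(** Both variables are discrete, so splitting over the values of [U] and then of [V] gives a double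
    series that factors; no product measure enters. *)
Lemma integral_mul_indep d (T : measurableType d) (R : realType)
    (P : probability T R) (A : set T) (U V : T -> nat) :
  measurable A -> measurable_fun setT U -> measurable_fun setT V ->
  (forall a b, P (A `&` U @^-1` [set a] `&` V @^-1` [set b]) =
    P A * P (U @^-1` [set a]) * P (V @^-1` [set b]))%E ->
  (\int[P]_(w in A) (U w * V w)%:R%:E =
    P A * \int[P]_w (U w)%:R%:E * \int[P]_w (V w)%:R%:E)%E.
Proof.
move=> mA mU mV indep.
have n0 (k : nat) : (0 <= k%:R%:E :> \bar R)%E by rewrite lee_fin.
have i0 (W : T -> nat) : (0 <= \int[P]_w (W w)%:R%:E)%E.
  by apply: integral_ge0 => w _.
have EX (W : T -> nat) : measurable_fun setT W -> (\int[P]_w (W w)%:R%:E =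
    \sum_(k <oo) k%:R%:E * P (W @^-1` [set k]))%E.
  move=> mW; rewrite (@integral_nat_comp _ _ _ P setT W (fun k => k%:R%:E))//.
  by under eq_eseriesr do rewrite setTI.
have mUa a : measurable (U @^-1` [set a]) by exact: measurable_nat_preimage.
rewrite (@integral_natcase _ _ _ _ _ U (fun a w => (a * V w)%:R%:E))//; last first.
  move=> k; apply: measurable_fun_natrE.
  exact: (@measurable_fun_natcase _ _ _ _ V (fun b _ => (k * b)%N)).
rewrite muleAC (EX U)// -nneseriesZl_ereal//; last 2 first.
- by rewrite mule_ge0.
- by move=> a; rewrite mule_ge0.
apply: eq_eseriesr => a _.
rewrite (@integral_nat_comp _ _ _ P _ V (fun b => (a * b)%:R%:E))//; last first.
  exact: measurableI.
rewrite (EX V)// [RHS]muleAC -nneseriesZl_ereal//; last 2 first.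
- by rewrite !mule_ge0.
- by move=> b; rewrite mule_ge0.
apply: eq_eseriesr => b _.
rewrite [X in (_ * X)%E](indep a b) natrM EFinM !muleA; congr (_ * _)%E.
by rewrite [RHS]muleAC; congr (_ * _)%E; rewrite muleC muleA.
Qed.

(** * Second moments and the criterion for overdispersion *)

(** The formula Var f = E[f^2] - (E f)^2, written additively so that it stays meaningful when the
    second moment is infinite. *)
Lemma integral_sqr_dev d (T : measurableType d) (R : realType)
    (P : probability T R) (f : T -> R) (c : R) :
  measurable_fun setT f -> (forall w, 0 <= f w) ->
  (\int[P]_w (f w)%:E = c%:E)%E ->
  (\int[P]_w ((f w - c) ^+ 2)%:E + (c ^+ 2)%:E = \int[P]_w (f w ^+ 2)%:E)%E.
Proof.
move=> mf f0 fc.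
have c0 : 0 <= c.
  by rewrite -lee_fin -fc; apply: integral_ge0 => w _; rewrite lee_fin.
have mc : measurable_fun setT (fun w => f w - c) by exact: measurable_funB.
(* In this form both sides are sums of integrals of nonnegative functions, each equal to the
   integral of f^2 + c^2. Cancelling the finite [c ^+ 2] is safe even if the integrals are
   infinite. *)
suff : (\int[P]_w ((f w - c) ^+ 2)%:E + (2 * c * c)%:E =
    \int[P]_w (f w ^+ 2)%:E + (c ^+ 2)%:E)%E.
  set V := (\int[P]_w ((f w - c) ^+ 2)%:E)%E; set W := (\int[P]_w (f w ^+ 2)%:E)%E.
  case: V => [v| |]; case: W => [x| |] //.
  by rewrite -!EFinD => -[e]; congr EFin; lra.
transitivity (\int[P]_w (f w ^+ 2 + c ^+ 2)%:E)%E.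
  rewrite EFinM -fc -ge0_integralZl//; last 3 first.
  - exact/measurable_EFinP.
  - by move=> w _; rewrite lee_fin.
  - by rewrite lee_fin mulr_ge0.
  rewrite -ge0_integralD//.
  - by apply: eq_integral => w _; rewrite -EFinM -EFinD; congr EFin; ring.
  - by move=> w _; rewrite lee_fin sqr_ge0.
  - exact/measurable_EFinP/measurable_funX.
  - by move=> w _; rewrite -EFinM lee_fin !mulr_ge0.
  - by apply: measurable_funeM; exact/measurable_EFinP.
rewrite -[X in (_ + X)%E]mule1 -(@probability_setT _ _ _ P) -integral_cst//.
rewrite -ge0_integralD//; last 3 first.
- by move=> w _; rewrite lee_fin sqr_ge0.
- exact/measurable_EFinP/measurable_funX.
- by move=> w _; rewrite lee_fin sqr_ge0.
Qed.

(** Since Z^2 = Z(Z - 1) + Z, also at Z = 0 where [.-1] truncates, the difference is E[Z(Z - 1)] -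
    (E Z)^2. Only the mean has to be finite: an infinite second factorial moment makes the variance
    infinite. *)
Lemma overdispersion_criterion d (T : measurableType d) (R : realType)
    (P : probability T R) (Z : T -> nat) : measurable_fun setT Z ->
  (\int[P]_w (Z w)%:R%:E < +oo)%E ->
  ((\int[P]_w (Z w)%:R%:E) ^+ 2 < \int[P]_w (Z w * (Z w).-1)%:R%:E)%E ->
  (0 < 'V_P[fun w => (Z w)%:R] - 'E_P[fun w => (Z w)%:R])%E.
Proof.
move=> mZ Zoo; rewrite /variance covariance.unlock expectation.unlock.
have [c mc] : exists c, (\int[P]_w (Z w)%:R%:E = c%:E)%E.
  exists (fine (\int[P]_w (Z w)%:R%:E)%E); rewrite fineK// ge0_fin_numE//.
  by apply: integral_ge0 => w _.
have mZf (f : nat -> R) : measurable_fun setT (fun w => f (Z w)).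
  exact: (@measurable_fun_natcase _ _ _ _ Z (fun k _ => f k)).
rewrite mc -EFin_expe [fine _]/= => cZ.
have := integral_sqr_dev (mZf (fun k => k%:R)) (fun w => ler0n R (Z w)) mc.
have -> : (\int[P]_w ((Z w)%:R ^+ 2)%:E =
    \int[P]_w (Z w * (Z w).-1)%:R%:E + c%:E)%E.
  rewrite -mc -ge0_integralD//; last 2 first.
  - exact/measurable_EFinP/(mZf (fun k => (k * k.-1)%:R)).
  - exact/measurable_EFinP/(mZf (fun k => k%:R)).
  apply: eq_integral => w _; rewrite -EFinD -natrD -natrX; congr (_%:R%:E).
  by case: (Z w) => //= n; rewrite -[X in (_ + X)%N]muln1 -mulnDr addn1.
under eq_integral do rewrite expr2.
rewrite sube_gt0; move: cZ.
set V := (\int[P]_w _)%E; set W := (\int[P]_w _)%E.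
case: V => [v| |]; case: W => [x| |] //=; rewrite ?ltry//.
by rewrite -!EFinD !lte_fin => h [e]; lra.
Qed.

(** * Factorial moments of the Poisson law *)

(* Unlike [poisson_pmf], this is the Poisson mass function also at rate 0. *)
Definition pois (R : realType) (k : nat) (x : R) : R :=
  x ^+ k * k`!%:R^-1 * expR (- x).

Lemma pois_ge0 (R : realType) k (x : R) : 0 <= x -> 0 <= pois k x.
Proof. by move=> x0; rewrite !mulr_ge0 ?exprn_ge0 ?expR_ge0. Qed.

Lemma continuous_pois (R : realType) k : continuous (@pois R k).
Proof.
move=> x; apply: cvgM.
  by apply: cvgM; [exact: exprn_continuous|exact: cvg_cst].
apply: continuous_comp; first exact: opp_continuous.
exact: continuous_expR.
Qed.

Lemma measurable_pois (R : realType) k : measurable_fun setT (@pois R k).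
Proof. by apply: continuous_measurable_fun; exact: continuous_pois. Qed.

(** For [x > 0] this is the total mass of [poisson_prob]; at [x = 0] only the term [k = 0] survives,
    as 0^0 = 1. *)
Lemma sum_pois (R : realType) (x : R) : 0 <= x ->
  (\sum_(k <oo) (pois k x)%:E = 1)%E.
Proof.
rewrite le_eqVlt => /predU1P[<-|x0].
  rewrite nneseries_recl//; last by move=> k _; rewrite lee_fin pois_ge0.
  rewrite {1}/pois expr0 fact0 invr1 oppr0 expR0 !mulr1 eseries0 ?adde0//.
  by move=> [//|i] _ _; rewrite /pois expr0n /= !mul0r.
have := @probability_setT _ _ _ (poisson_prob x 0%N).
rewrite /= /poisson_prob x0 -nneseries_esumT; last first.
  by move=> k; rewrite lee_fin poisson_pmf_ge0.
by under eq_eseriesr => k _ do rewrite /poisson_pmf x0.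
Qed.

(** This recursion shifts the index in the moment series and pulls out a factor [x]: the first
    moment reduces to the total mass, the second factorial moment to the first. *)
Lemma pois_succ (R : realType) k (x : R) :
  k.+1%:R * pois k.+1 x = x * pois k x.
Proof.
have k0 : (k.+1%:R != 0 :> R) by rewrite pnatr_eq0.
rewrite /pois factS natrM invfM exprS !mulrA; congr (_ * _ * _).
by rewrite -[_ * x * _]mulrA mulrAC mulfV// mul1r.
Qed.

Lemma pois_moment1 (R : realType) (x : R) : 0 <= x ->
  (\sum_(k <oo) k%:R%:E * (pois k x)%:E = x%:E)%E.
Proof.
move=> x0; have p0 k : (0 <= (pois k x)%:E)%E by rewrite lee_fin pois_ge0.
have n0 (k : nat) : (0 <= k%:R%:E :> \bar R)%E by rewrite lee_fin.
rewrite nneseries_recl//; last by move=> k _; rewrite mule_ge0.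
rewrite mul0e add0e -(nneseries_addn 1); last by move=> k; rewrite mule_ge0.
under eq_eseriesr => k _ do rewrite addn1 -EFinM pois_succ EFinM.
by rewrite nneseriesZl// sum_pois// mule1.
Qed.

Lemma pois_factorial_moment2 (R : realType) (x : R) : 0 <= x ->
  (\sum_(k <oo) (k * k.-1)%:R%:E * (pois k x)%:E = (x ^+ 2)%:E)%E.
Proof.
move=> x0; have p0 k : (0 <= (pois k x)%:E)%E by rewrite lee_fin pois_ge0.
have n0 (k : nat) : (0 <= k%:R%:E :> \bar R)%E by rewrite lee_fin.
rewrite nneseries_recl//; last by move=> k _; rewrite mule_ge0.
rewrite mul0e add0e -(nneseries_addn 1); last by move=> k; rewrite mule_ge0.
under eq_eseriesr => k _.
  rewrite addn1 /= mulnC natrM -EFinM -mulrA pois_succ mulrCA 2!EFinM; over.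
rewrite nneseriesZl//; last by move=> k _; rewrite mule_ge0.
by rewrite pois_moment1// -EFinM.
Qed.

(** * The mixed Poisson law of a Poisson process at an independent random time *)

Lemma measurable_truncn (R : realType) :
  measurable_fun setT (fun x : R => Num.truncn x).
Proof.
move=> _ A _; rewrite setTI.
rewrite (_ : _ @^-1` A = \bigcup_(k in A) [set x : R | Num.truncn x = k]).
  apply: bigcup_measurable => -[|k] _.
    (* [Num.truncn] is also 0 on negative reals, so the fibre of 0 is a half-line. *)
    rewrite (_ : [set x | _] = `]-oo, 1[%classic)//.
    by apply/seteqP; split => x /=; rewrite in_itv/= ltNge => /truncn0Pn.
  rewrite (_ : [set x | _] = `[k.+1%:R, k.+2%:R[%classic)//.
  apply/seteqP; split => x /=; rewrite in_itv/=.
    move=> xk; rewrite -xk truncnS_gt andbT truncn_le.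
    by rewrite ltW// (lt_le_trans ltr01)// -truncn_gt0 xk.
  exact: truncn_def.
by apply/seteqP; split => [x Ax|x [k Ak /= ->]//]; exists (Num.truncn x).
Qed.

(** Joint measurability of [N] in time and [w] is not given, so Fubini does not apply directly. For
    a random time with countably many values, independence gives the formula on each level set;
    dominated convergence then passes to [Y]. *)
Lemma poisson_mixture_pmf d (T : measurableType d) (R : realType)
    (P : probability T R) (lambda : R) (N : R -> T -> nat) (Y : T -> R)
    (M : T -> nat) :
  0 < lambda -> poisson_process P lambda N ->
  measurable_fun setT Y -> (forall w, 0 <= Y w) ->
  measurable_fun setT M -> (forall w, M w = N (Y w) w) ->
  (forall q A B, 0 <= q -> measurable A -> measurable B ->
    P (N q @^-1` A `&` Y @^-1` B) = (P (N q @^-1` A) * P (Y @^-1` B))%E) ->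
  forall k, P (M @^-1` [set k]) = (\int[P]_w (pois k (lambda * Y w))%:E)%E.
Proof.
move=> lambda0 [levyN pmfN] mY Y0 mM MNY indep k.
have mN q : 0 <= q -> measurable_fun setT (N q).
  by move=> q0; exact/measurable_fun_natr/(levy_measurable levyN).
(* Y is approximated strictly from the right, along which N is continuous, by
   the countably valued [q n (J n)]. *)
pose J n w := Num.truncn (n.+1%:R * Y w).
(* The successor in [j.+1] puts [q n (J n w)] strictly above [Y w], as right limits require, and
   makes it positive, as the mass function in [poisson_process] requires. *)
pose q (n j : nat) : R := j.+1%:R / n.+1%:R.
have q0 n j : 0 < q n j by rewrite divr_gt0.
have mJ n : measurable_fun setT (J n).
  apply: (measurableT_comp (@measurable_truncn R)).
  exact: measurable_funM.
have YJ n w : Y w < q n (J n w) <= Y w + n.+1%:R^-1.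
  have nY0 : 0 <= n.+1%:R * Y w by rewrite mulr_ge0.
  have /andP[lo hi] := truncn_itv nY0.
  rewrite ltr_pdivlMr// mulrC hi /= ler_pdivrMr// mulrDl mulVf ?pnatr_eq0//.
  by rewrite -natr1 lerD2r mulrC.
have cvgYJ w : q n (J n w) @[n --> \oo] --> Y w.
  apply: (@squeeze_cvgr _ _ _ _ (cst (Y w)) (fun n => Y w + n.+1%:R^-1)).
  - by near=> n; have /andP[/ltW -> ->] := YJ n w.
  - exact: cvg_cst.
  - rewrite -[X in _ --> X]addr0; apply: cvgD; first exact: cvg_cst.
    exact: cvg_harmonic.
pose f n w : \bar R := (N (q n (J n w)) w == k)%:R%:E.
pose g n w : \bar R := (pois k (lambda * q n (J n w)))%:E.
have mNk n j : measurable_fun setT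
    (fun w => (N (q n j) w == k)%:R%:E : \bar R).
  exact: (@measurable_fun_natcase _ _ _ _ (N (q n j))
    (fun i _ => (i == k)%:R%:E) (mN _ (ltW (q0 n j)))).
have fg n : (\int[P]_w f n w = \int[P]_w g n w)%E.
  rewrite /f (@integral_natcase _ _ _ P setT (J n)
    (fun j w => (N (q n j) w == k)%:R%:E))//.
  rewrite /g (@integral_nat_comp _ _ _ P setT (J n)
    (fun j => (pois k (lambda * q n j))%:E))//; last first.
    by move=> j; rewrite lee_fin pois_ge0// mulr_ge0// ltW.
  apply: eq_eseriesr => j _; rewrite setTI.
  transitivity (\int[P]_(w in J n @^-1` [set j]) (\1_(N (q n j) @^-1` [set k]) w)%:E)%E.
    apply: eq_integral => w _; rewrite indicE; congr ((nat_of_bool _)%:R%:E).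
    by apply/eqP/idP => [?|]; rewrite inE.
  rewrite integral_indic; last 2 first.
  - exact: measurable_nat_preimage.
  - by apply: measurable_nat_preimage; exact/mN/ltW.
  have -> : J n @^-1` [set j] =
      Y @^-1` ((fun x => Num.truncn (n.+1%:R * x)) @^-1` [set j]) by [].
  rewrite [LHS]indep ?ltW//; last first.
    apply: measurable_nat_preimage; apply: (measurableT_comp (@measurable_truncn R)).
    exact: measurable_funM.
  congr (_ * _)%E; rewrite [LHS]pmfN// /poisson_pmf mulr_gt0//.
have dom_f w n : setT w -> (`|f n w| <= cst 1%E w)%E.
  by move=> _; rewrite /f /cst abse_EFin lee_fin ger0_norm// lern1; case: eqP.
have dom_g w n : setT w -> (`|g n w| <= cst 1%E w)%E.
  move=> _; have x0 : 0 < lambda * q n (J n w) by rewrite mulr_gt0.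
  (* With [w] fixed, the Poisson weight is itself a probability, hence at most 1. *)
  have -> : g n w = P [set w' | N (q n (J n w)) w' = k].
    by rewrite pmfN// /poisson_pmf x0.
  rewrite gee0_abs//; apply: probability_le1.
  exact/(measurable_nat_preimage [set k])/mN/ltW.
have i1 : P.-integrable setT (cst 1%E).
  exact: finite_measure_integrable_cst.
have mf n : measurable_fun setT (f n).
  exact: (@measurable_fun_natcase _ _ _ _ (J n)
    (fun j w => (N (q n j) w == k)%:R%:E)).
have mg n : measurable_fun setT (g n).
  exact: (@measurable_fun_natcase _ _ _ _ (J n)
    (fun j _ => (pois k (lambda * q n j))%:E)).
have mMk : measurable_fun setT (fun w => (M w == k)%:R%:E : \bar R).
  exact: (@measurable_fun_natcase _ _ _ _ M (fun i _ => (i == k)%:R%:E)).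
have cvg_f : (fun n => \int[P]_w f n w)%E @ \oo -->
    (\int[P]_w (M w == k)%:R%:E)%E.
  have f_M : {ae P, forall w, setT w -> f ^~ w @ \oo --> ((M w == k)%:R%:E : \bar R)}.
    have [A [mA PA subA]] := levy_cadlag levyN.
    exists A; split => // w /= nw; apply: subA => cadw; apply: nw => _.
    have /cvg_at_rightP rc := cadw.1 _ (Y0 w).
    have /rc : (forall n, Y w < q n (J n w)) /\ q n (J n w) @[n --> \oo] --> Y w.
      by split => // n; have /andP[] := YJ n w.
    (* Naturals at distance less than 1 are equal, so the indicators are eventually constant along
       the sequence. *)
    move=> /cvgrPdist_lt/(_ 1 ltr01) near1.
    apply: cvg_near_cst; near=> n.
    rewrite /f MNY; congr ((nat_of_bool (_ == _))%:R%:E).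
    have : `|(N (Y w) w)%:R - (N (q n (J n w)) w)%:R : R| < 1 by near: n.
    rewrite ltr_norml => /andP[lo hi]; apply/eqP.
    by rewrite eqn_leq; apply/andP; split; rewrite -ltnS -(ltr_nat R) -natr1; lra.
  have f_1 : {ae P, forall w n, setT w -> (`|f n w| <= cst 1%E w)%E}.
    by apply: aeW => w n; exact: dom_f.
  by case: (dominated_convergence measurableT mf mMk f_M i1 f_1).
have mpY : measurable_fun setT (fun w => (pois k (lambda * Y w))%:E).
  apply/measurable_EFinP; apply: (measurableT_comp (@measurable_pois R k)).
  exact: measurable_funM.
have cvg_g : (fun n => \int[P]_w g n w)%E @ \oo -->
    (\int[P]_w (pois k (lambda * Y w))%:E)%E.
  have g_Y : {ae P, forall w, setT w -> g ^~ w @ \oo --> (pois k (lambda * Y w))%:E}.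
    apply: aeW => w _; apply: cvg_EFin; first exact: nearW.
    apply: (continuous_cvg _ (@continuous_pois R k _)).
    by apply: cvgM; [exact: cvg_cst|exact: cvgYJ].
  have g_1 : {ae P, forall w n, setT w -> (`|g n w| <= cst 1%E w)%E}.
    by apply: aeW => w n; exact: dom_g.
  by case: (dominated_convergence measurableT mg mpY g_Y i1 g_1).
have <- : (\int[P]_w (M w == k)%:R%:E = P (M @^-1` [set k]))%E.
  rewrite -[M @^-1` _]setIT -integral_indic//; last first.
    exact: measurable_nat_preimage.
  apply: eq_integral => w _; rewrite indicE; congr ((nat_of_bool _)%:R%:E).
  by apply/eqP/idP => [?|]; rewrite inE.
apply: (cvg_unique _ cvg_f); first exact: ereal_hausdorff.
by rewrite (funext fg).
Unshelve. all: by end_near.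
Qed.

(** Strict Jensen inequality for the square: equality would make the integral of [(f w - c) ^+ 2]
    vanish, with [c] the mean, and hence [f] almost surely equal to [c]. *)
Lemma sqr_integral_lt d (T : measurableType d) (R : realType)
    (P : probability T R) (f : T -> R) :
  measurable_fun setT f -> (forall w, 0 <= f w) ->
  (\int[P]_w (f w)%:E < +oo)%E ->
  (forall c, ~ {ae P, forall w, f w = c}) ->
  ((\int[P]_w (f w)%:E) ^+ 2 < \int[P]_w (f w ^+ 2)%:E)%E.
Proof.
move=> mf f0 foo nc.
have [c fc] : exists c, (\int[P]_w (f w)%:E = c%:E)%E.
  exists (fine (\int[P]_w (f w)%:E)%E); rewrite fineK// ge0_fin_numE//.
  by apply: integral_ge0 => w _; rewrite lee_fin.
rewrite -(integral_sqr_dev mf f0 fc) fc -EFin_expe lteDr//.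
rewrite lt0e; apply/andP; split; last first.
  by apply: integral_ge0 => w _; rewrite lee_fin sqr_ge0.
apply/eqP => V0; apply: (nc c).
have mfc : measurable_fun setT (fun w => ((f w - c) ^+ 2)%:E).
  by apply/measurable_EFinP/measurable_funX; exact: measurable_funB.
have : (\int[P]_w `|((f w - c) ^+ 2)%:E| = 0)%E.
  by rewrite -V0; apply: eq_integral => w _; rewrite gee0_abs// lee_fin sqr_ge0.
move=> /(ae_eq_integral_abs P measurableT mfc); apply: filterS => w /(_ I)/eqP.
by rewrite eqe sqrf_eq0 subr_eq0 => /eqP.
Qed.

(** * The inverse of the mixed stable subordinator: finite mean and non-degeneracy *)

Section inverse_subordinator.
Context d (T : measurableType d) (R : realType) (P : probability T R).
Variables (a1 a2 C1 C2 : R) (D : R -> T -> R).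
Hypotheses (a21 : a2 < a1) (a1_lt1 : a1 < 1).
Hypotheses (C2_ge0 : 0 <= C2) (C12 : C1 + C2 = 1).
Hypothesis hD : mixed_stable_subordinator P a1 a2 C1 C2 D.

Let phi s := C1 * s `^ a1 + C2 * s `^ a2.

Let phi1 : phi 1 = 1.
Proof. by rewrite /phi !powR1 !mulr1. Qed.

Let mD s : 0 <= s -> measurable_fun setT (D s).
Proof. by move=> s0; exact: (levy_measurable hD.1.1). Qed.

Let mDle s t : 0 <= s -> measurable [set w | D s w <= t].
Proof.
move=> s0; rewrite (_ : [set w | _] = D s @^-1` `]-oo, t]).
  by rewrite -[X in measurable X]setTI; exact: mD.
by apply/seteqP; split => w /=; rewrite in_itv.
Qed.

(** Markov's inequality for e^(-th D_s): on the event, e^(th t) e^(-th D_s) is at least 1, and its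
    expectation is given by the Laplace transform. *)
Lemma subordinator_chernoff s t th : 0 <= s -> 0 <= th ->
  (P [set w | (D s w <= t)%R] <= (expR (th * t - s * phi th))%:E)%E.
Proof.
move=> s0 th0; rewrite expRD EFinM -(hD.2 s th s0 th0) expectation.unlock.
have me : measurable_fun setT (fun w => (expR (- (th * D s w)))%:E).
  apply/measurable_EFinP; apply: measurableT_comp => //.
  by apply: measurableT_comp => //; apply: measurable_funM => //; exact: mD.
rewrite -ge0_integralZl//.
rewrite -[X in P X]setIT -integral_indic//; last exact: mDle.
apply: ge0_le_integral => //.
- by apply/measurable_EFinP; exact/measurable_indic/mDle.
- exact: measurable_funeM.
- move=> w _; rewrite -EFinM -expRD lee_fin indicE.
  have [/set_mem /= Dt|_] := boolP (w \in _); last exact: expR_ge0.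
  by rewrite -expR0 ler_expR -mulrBr mulr_ge0// subr_ge0.
Qed.

Lemma subordinator_tail s t : 0 <= s ->
  (P [set w | (D s w <= t)%R] <= (expR (t - s))%:E)%E.
Proof. by move=> s0; have := @subordinator_chernoff s t 1 s0 ler01; rewrite phi1 mul1r mulr1. Qed.

(* [phi th / th] tends to infinity at 0, which contradicts the Chernoff bound
   when [D s <= t] almost surely. *)
Lemma subordinator_exceeds s t : 0 < s -> 0 < t ->
  (P [set w | (D s w <= t)%R] < 1)%E.
Proof.
move=> s0 t0; rewrite ltNge; apply/negP => P1.
(* Here [c * t < s], and [th] below solves th = c th^a1. The bound [c <= 1] gives [th <= 1], hence
   th^a2 >= th^a1 and phi(th) >= th^a1. Chernoff with an almost sure event forces s phi(th) <= th t,
   so s <= c t. *)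
pose c := Num.min 1 (s / (2 * t)).
have c0 : 0 < c by rewrite lt_min ltr01 divr_gt0// mulr_gt0.
have ct : c * t < s.
  apply: (@le_lt_trans _ _ (s / (2 * t) * t)).
    by rewrite ler_pM2r// ge_min lexx orbT.
  have -> : s / (2 * t) * t = s / 2 by field; lra.
  lra.
have a1' : 0 < 1 - a1 by rewrite subr_gt0.
pose th := c `^ (1 - a1)^-1.
have th0 : 0 < th by exact: powR_gt0.
have th1 : th <= 1.
  have cinv : 0 <= (1 - a1)^-1 by rewrite invr_ge0 ltW.
  have := @ge0_ler_powR R _ cinv c 1; rewrite powR1; apply.
  - by rewrite nnegrE ltW.
  - by rewrite nnegrE.
  - by rewrite ge_min lexx.
have thE : th = th `^ a1 * c.
  have -> : th `^ a1 * c = th `^ a1 * th `^ (1 - a1).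
    by congr (_ * _); rewrite -powRrM mulVf ?gt_eqF// powRr1// ltW.
  by rewrite -powRD ?(gt_eqF th0) ?implybT// subrKC powRr1// ltW.
have : th `^ a1 <= phi th.
  rewrite -[leLHS]mul1r -C12 mulrDl lerD2l ler_wpM2l//.
  by apply: ger_powR; [rewrite th0|exact: ltW].
have tha0 : 0 < th `^ a1 by exact: powR_gt0.
have := le_trans P1 (@subordinator_chernoff s t th (ltW s0) (ltW th0)).
rewrite lee_fin -expR0 ler_expR subr_ge0 => h1 h2.
have : s * th `^ a1 <= th * t by rewrite (le_trans _ h1)// ler_pM2l.
rewrite {2}thE -mulrA mulrC ler_pM2l//; lra.
Qed.

(** If D at time t/2 were almost surely above [t], its Laplace transform at 1 would be at most
    e^(-t), whereas it equals e^(-t/2). *)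
Lemma subordinator_not_exceeds t : 0 < t ->
  (0 < P [set w | (D (t / 2)%R w <= t)%R])%E.
Proof.
move=> t0; have t2 : 0 <= t / 2 by lra.
rewrite lt0e measure_ge0 andbT; apply/eqP => P0.
have : ('E_P[fun w => expR (- (1 * D (t / 2) w))] <= (expR (- t))%:E)%E.
  rewrite expectation.unlock -[leRHS]mule1 -(@probability_setT _ _ _ P) -integral_cst//.
  apply: ae_ge0_le_integral => //.
  - apply/measurable_EFinP; apply: measurableT_comp => //.
    by apply: measurableT_comp => //; apply: measurable_funM => //; exact: mD.
  - by move=> w _; rewrite lee_fin expR_ge0.
  - exists [set w | D (t / 2) w <= t]; split => //; first exact: mDle.
    move=> w /=; apply: contra_notP => /negP; rewrite -ltNge => tD _.
    by rewrite lee_fin ler_expR mul1r lerN2 ltW.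
rewrite hD.2// -/(phi 1) phi1 lee_fin ler_expR; lra.
Qed.

Lemma first_passage_ge0 t w : 0 <= first_passage D t w.
Proof.
rewrite /first_passage; have [->|ne] := eqVneq [set s | 0 <= s /\ t < D s w] set0.
  by rewrite inf0.
by apply: lb_le_inf; [exact/set0P|move=> s []].
Qed.

(** Otherwise [s] would belong to the passage set and the infimum could not exceed it. *)
Lemma first_passage_gt t w s :
  0 <= s -> s < first_passage D t w -> D s w <= t.
Proof.
move=> s0 sY; rewrite leNgt; apply/negP => tD; move: sY; apply/negP.
by rewrite -leNgt; apply: ge_inf => //; exists 0 => ? [].
Qed.

Variables (t : R) (Y : {RV P >-> R}).
Hypothesis t_gt0 : 0 < t.
Hypothesis YE : forall w, Y w = first_passage D t w.

Let Y_ge0 w : 0 <= Y w. Proof. by rewrite YE first_passage_ge0. Qed.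

Lemma first_passage_tail r : 0 <= r ->
  (P [set w | (r < Y w)%R] <= (expR (t - r))%:E)%E.
Proof.
move=> r0; apply: le_trans (subordinator_tail t r0).
apply: le_measure; rewrite ?inE.
- rewrite -[X in measurable X]setTI (_ : [set w | _] = Y @^-1` `]r, +oo[).
    exact: measurable_funPT.
  by apply/seteqP; split => w /=; rewrite in_itv/= andbT.
- exact: mDle.
- by move=> w /=; rewrite YE; exact: first_passage_gt.
Qed.

(** The mean is the integral of the tail P(Y > r) over r >= 0. The tail is at most e^t times the
    exponential density of rate 1, whose integral is 1. *)
Lemma first_passage_integrable : (\int[P]_w (Y w)%:E < +oo)%E.
Proof.
rewrite -expectation_def ge0_expectation_ccdf//.
apply: (@le_lt_trans _ _ ((expR t)%:E)); last exact: ltry.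
pose mu := @lebesgue_measure R.
have mpdf : measurable_fun setT (fun r : R => (expR t)%:E * (exponential_pdf 1 r)%:E)%E.
  by apply: measurable_funeM; apply/measurable_EFinP; exact: measurable_exponential_pdf.
have pdf0 (r : R) : (0 <= (expR t)%:E * (exponential_pdf 1 r)%:E)%E.
  by rewrite -EFinM lee_fin mulr_ge0 ?expR_ge0 ?exponential_pdf_ge0.
apply: (@le_trans _ _ (\int[mu]_(r in `[0%R, +oo[) ((expR t)%:E * (exponential_pdf 1 r)%:E))%E).
  apply: ge0_le_integral => //.
  - by apply: measurable_funTS; exact: ccdf_measurable.
  - exact: measurable_funTS.
  - move=> x; rewrite /= in_itv /= andbT => x0.
    rewrite exponential_pdfE// mul1r mulN1r -EFinM -expRD.
    apply: le_trans (first_passage_tail x0); rewrite /ccdf /distribution /pushforward.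
    by rewrite set_itvoy.
apply: (@le_trans _ _ (\int[mu]_r ((expR t)%:E * (exponential_pdf 1 r)%:E))%E).
  exact: ge0_subset_integral.
rewrite ge0_integralZl//; last 2 first.
- by apply/measurable_EFinP; exact: measurable_exponential_pdf.
- by move=> x _; rewrite lee_fin exponential_pdf_ge0.
by rewrite integral_exponential_pdf// mule1.
Qed.

(** If [c > 0], then D at time c/2 would almost surely not exceed [t], against
    [subordinator_exceeds]. If [c <= 0], then Y >= t/2 > 0 almost surely on the event that D at time
    t/2 is at most [t], which has positive probability. *)
Lemma first_passage_nonconstant c : ~ {ae P, forall w, Y w = c}.
Proof.
move=> Yc.
have c_le0 : c <= 0.
  rewrite leNgt; apply/negP => c0.
  have c2 : 0 < c / 2 by lra.
  have := subordinator_exceeds c2 t_gt0; rewrite ltNge => /negP; apply.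
  have -> : (1 = 1 - P (~` [set w | (D (c / 2) w <= t)%R]))%E.
    rewrite (@measure_negligible _ _ _ P (~` _)) ?sube0//.
      by apply: measurableC; exact/mDle/ltW.
    apply: negligibleS Yc => w /= /negP; rewrite -ltNge => tD Ywc.
    have : Y w <= c / 2.
      by rewrite YE leNgt; apply/negP => /(first_passage_gt (ltW c2)); rewrite leNgt tD.
    by rewrite Ywc; lra.
  rewrite -probability_setC; last by apply: measurableC; exact/mDle/ltW.
  by rewrite setCK.
have := subordinator_not_exceeds t_gt0; rewrite lt0e => /andP[/eqP + _]; apply.
have t2 : 0 <= t / 2 by rewrite divr_ge0// ltW.
apply: measure_negligible; first exact: mDle.
have [_ D_mono] := hD.1.
(* On an empty passage set the infimum is 0, so this event must be discarded. *)
have D_unbounded : P.-negligible [set w | forall n : nat, D n%:R w <= t].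
  pose A n := [set w | D n%:R w <= t].
  have mA : measurable (\bigcap_n A n).
    by apply: bigcapT_measurable => n; exact: mDle.
  exists (\bigcap_n A n); split => //; last by move=> w Dw n _; exact: Dw.
  have PA n : (P (\bigcap_n A n) <= (expR (t - n%:R))%:E)%E.
    apply: le_trans (subordinator_tail t (ler0n R n)).
    by apply: le_measure; rewrite ?inE//; [exact: mDle|move=> w; apply].
  apply/eqP; rewrite eq_le measure_ge0 andbT.
  have expR_cvg0 : (expR (t - n%:R))%:E @[n --> \oo] --> (0 : \bar R).
    rewrite -(mule0 (expR t)%:E); under eq_fun do rewrite expRD EFinM.
    by apply: cvgeZl => //; apply: cvg_EFin; [exact: nearW|exact: cvgn_expR].
  by apply: (cvge_to_ge expR_cvg0); exact: nearW.
apply: negligibleS (negligibleU Yc (negligibleU D_mono D_unbounded)) => w /= Dt.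
apply: contrapT => /not_orP[/contrapT Ywc /not_orP[/contrapT mono /existsNP[n /negP]]].
rewrite -ltNge => tDn.
have : t / 2 <= Y w.
  rewrite YE; apply: lb_le_inf; first by exists n%:R; split.
  move=> r [r0 tDr]; rewrite leNgt; apply/negP => rt.
  by have := mono r (t / 2) r0 (ltW rt); lra.
by move: t_gt0; rewrite Ywc; lra.
Qed.

End inverse_subordinator.

(** * Moments of a Poisson mixture *)

(** Tonelli exchanges the sum over [k] with the integral over [w]. The pair [h], [m] is a statistic
    with its Poisson mean, instantiated later by the two factorial moments. *)
Lemma poisson_mixture_expectation d (T : measurableType d) (R : realType)
    (P : probability T R) (lambda : R) (Y : T -> R) (M : T -> nat)
    (h : nat -> nat) (m : R -> R) :
  0 <= lambda -> measurable_fun setT Y -> (forall w, 0 <= Y w) ->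
  measurable_fun setT M ->
  (forall k, P (M @^-1` [set k]) = (\int[P]_w (pois k (lambda * Y w))%:E)%E) ->
  (forall x, 0 <= x ->
    (\sum_(k <oo) (h k)%:R%:E * (pois k x)%:E = (m x)%:E)%E) ->
  (\int[P]_w (h (M w))%:R%:E = \int[P]_w (m (lambda * Y w))%:E)%E.
Proof.
move=> lambda0 mY Y0 mM law hm.
have p0 k w : 0 <= pois k (lambda * Y w) by rewrite pois_ge0// mulr_ge0.
have mp k : measurable_fun setT (fun w => (pois k (lambda * Y w))%:E).
  apply/measurable_EFinP; apply: (measurableT_comp (@measurable_pois R k)).
  exact: measurable_funM.
rewrite (@integral_nat_comp _ _ _ P setT M (fun k => (h k)%:R%:E))//.
under eq_eseriesr => k _.
  rewrite setTI [X in (_ * X)%E]law -ge0_integralZl//; last by move=> w _; rewrite lee_fin.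
  over.
rewrite -integral_nneseries//.
- by apply: eq_integral => w _; rewrite hm// mulr_ge0.
- by move=> k; exact: measurable_funeM.
- by move=> k w _; rewrite -EFinM lee_fin mulr_ge0.
Qed.

(** * Random sums: the mean and a lower bound for the second factorial moment *)

Lemma integral_nat_indep d (T : measurableType d) (R : realType)
    (P : probability T R) (A : set T) (V : T -> nat) :
  measurable A -> measurable_fun setT V ->
  (forall b, P (A `&` V @^-1` [set b]) = P A * P (V @^-1` [set b]))%E ->
  (\int[P]_(w in A) (V w)%:R%:E = P A * \int[P]_w (V w)%:R%:E)%E.
Proof.
move=> mA mV indep.
have n0 (k : nat) : (0 <= k%:R%:E :> \bar R)%E by rewrite lee_fin.
rewrite (@integral_nat_comp _ _ _ P A V (fun b => b%:R%:E))//.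
rewrite (@integral_nat_comp _ _ _ P setT V (fun b => b%:R%:E))//.
rewrite -nneseriesZl_ereal//.
by apply: eq_eseriesr => b _; rewrite [X in (_ * X)%E]indep setTI muleCA.
Qed.

Section random_sum.
Context d (T : measurableType d) (R : realType) (P : probability T R).
Variables (M : T -> nat) (X : nat -> T -> nat).
Hypothesis mM : measurable_fun setT M.
Hypothesis mX : forall i, measurable_fun setT (X i).
Variable mu : R.
Hypothesis EX : forall i, (\int[P]_w (X i w)%:R%:E = mu%:E)%E.
Hypothesis indepMX : forall m i b,
  P (M @^-1` [set m] `&` X i @^-1` [set b]) =
    (P (M @^-1` [set m]) * P (X i @^-1` [set b]))%E.
Hypothesis indepMXX : forall m i j a b, i != j ->
  P (M @^-1` [set m] `&` X i @^-1` [set a] `&` X j @^-1` [set b]) =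
    (P (M @^-1` [set m]) * P (X i @^-1` [set a]) * P (X j @^-1` [set b]))%E.

Let mMk m : measurable (M @^-1` [set m]).
Proof. exact: measurable_nat_preimage. Qed.

(** With [M t] in place of [M], [S (M w) w] unfolds to [compound X M t w]. *)
Let S m w := (\sum_(i < m) X i w)%N.

Let mS m : measurable_fun setT (S m).
Proof.
apply: (@measurable_fun_natr _ _ R).
under eq_fun do rewrite /S natr_sum.
apply: measurable_sum => i.
exact: (@measurable_fun_natcase _ _ _ _ (X i) (fun k _ => k%:R : R)).
Qed.

Lemma measurable_random_sum : measurable_fun setT (fun w => S (M w) w).
Proof. exact: measurable_fun_natcase. Qed.

(** Wald's identity: by independence, the event [M = m] contributes m mu P(M = m). *)
Lemma integral_random_sum :
  (\int[P]_w (S (M w) w)%:R%:E = mu%:E * \int[P]_w (M w)%:R%:E)%E.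
Proof.
have n0 (k : nat) : (0 <= k%:R%:E :> \bar R)%E by rewrite lee_fin.
have mu0 : (0 <= mu%:E)%E by rewrite -(EX 0%N) integral_ge0.
rewrite (@integral_natcase _ _ _ P setT M (fun m w => (S m w)%:R%:E))//; last first.
  by move=> m; exact: measurable_fun_natrE.
rewrite (@integral_nat_comp _ _ _ P setT M (fun m => m%:R%:E))//.
rewrite -nneseriesZl_ereal//.
apply: eq_eseriesr => m _; rewrite setTI.
under eq_integral do rewrite natr_sum -sumEFin.
rewrite ge0_integral_sum//; last first.
  by move=> i; apply: measurable_funTS; exact: measurable_fun_natrE.
have [x Px] : exists x, P (M @^-1` [set m]) = x%:E.
  by exists (fine (P (M @^-1` [set m]))); rewrite fineK// fin_num_measure.
under eq_bigr do rewrite (integral_nat_indep _ _ (indepMX _ _))// EX [X in (X * _)%E]Px -EFinM.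
rewrite sumEFin sumr_const card_ord -[_ *+ m]mulr_natl.
by rewrite [X in (_ * (_ * X))%E]Px -!EFinM; congr EFin; ring.
Qed.

(* The off-diagonal part of [S m w ^ 2]. *)
Let Q m w := (\sum_(i < m) \sum_(j < m) (i != j) * (X i w * X j w))%N.

(** S^2 is [Q] plus the sum of the X_i^2, and X_i^2 >= X_i for naturals. A zero sum is treated apart
    because of [.-1]; there all the X_i vanish. *)
Let leQ m w : (Q m w <= S m w * (S m w).-1)%N.
Proof.
rewrite -(leq_add2r (S m w)) -[X in (_ <= _ + X)%N]muln1 -mulnDr.
case: (posnP (S m w)) => [S0|]; last first.
  move=> S0; rewrite addn1 prednK// /S big_distrl /= /Q -big_split /=.
  apply: leq_sum => i _; rewrite big_distrr /= [leqRHS](bigD1 i)//=.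
  rewrite addnC leq_add//; first by case: (X i w) => // n; exact: leq_pmulr.
  rewrite [leqRHS]big_mkcond/=; apply: leq_sum => j _.
  by rewrite eq_sym; case: eqP => _; rewrite ?mul0n ?mul1n.
rewrite S0 mul0n addn0 leqn0; apply/eqP/big1 => i _; apply: big1 => j _.
have /eqP : X i w = 0%N.
  by apply/eqP; rewrite -leqn0 -S0 /S (bigD1 i)//= leq_addr.
by move=> /eqP ->; rewrite mul0n muln0.
Qed.

(** After [S (S - 1)] is bounded below by [Q], the rest is an equality: on [M = m] each of the m(m -
    1) ordered pairs contributes mu^2 P(M = m). *)
Lemma integral_random_sum_factorial2_ge :
  (mu%:E ^+ 2 * \int[P]_w (M w * (M w).-1)%:R%:E <=
   \int[P]_w (S (M w) w * (S (M w) w).-1)%:R%:E)%E.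
Proof.
have n0 (k : nat) : (0 <= k%:R%:E :> \bar R)%E by rewrite lee_fin.
have mu0 : (0 <= mu%:E)%E by rewrite -(EX 0%N) integral_ge0.
have mXX i j : measurable_fun setT (fun w => ((i != j) * (X i w * X j w))%N).
  apply: (@measurable_fun_natcase _ _ _ _ (X i)
    (fun a w => ((i != j) * (a * X j w))%N)) => // a.
  exact: (@measurable_fun_natcase _ _ _ _ (X j)
    (fun b w => ((i != j) * (a * b))%N)).
have mQr m : measurable_fun setT (fun w => (Q m w)%:R%:E : \bar R).
  apply/measurable_EFinP; under eq_fun do rewrite /Q natr_sum.
  apply: measurable_sum => i; under eq_fun do rewrite natr_sum.
  by apply: measurable_sum => j; exact/measurable_EFinP/(measurable_fun_natrE (mXX i j)).
apply: (@le_trans _ _ (\int[P]_w (Q (M w) w)%:R%:E)%E); last first.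
  apply: ge0_le_integral => //.
  - exact: (@measurable_fun_natcase _ _ _ _ M (fun m w => (Q m w)%:R%:E)).
  - apply: (measurable_fun_natrE (U := fun w => (S (M w) w * (S (M w) w).-1)%N)).
    exact: (@measurable_fun_natcase _ _ _ _ (fun w => S (M w) w)
      (fun s w => (s * s.-1)%N) measurable_random_sum).
  - by move=> w _; rewrite lee_fin ler_nat.
rewrite (@integral_natcase _ _ _ P setT M (fun m w => (Q m w)%:R%:E))//.
rewrite (@integral_nat_comp _ _ _ P setT M (fun m => (m * m.-1)%:R%:E))//.
rewrite -nneseriesZl_ereal//; last first.
  by rewrite -EFin_expe lee_fin sqr_ge0.
rewrite le_eqVlt; apply/orP; left; apply/eqP/eq_eseriesr => m _; rewrite setTI.
under [RHS]eq_integral do rewrite natr_sum -sumEFin.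
rewrite ge0_integral_sum//; last first.
  move=> i; apply: measurable_funTS; apply/measurable_EFinP.
  under eq_fun do rewrite natr_sum.
  by apply: measurable_sum => j; exact/measurable_EFinP/(measurable_fun_natrE (mXX i j)).
have [x Px] : exists x, P (M @^-1` [set m]) = x%:E.
  by exists (fine (P (M @^-1` [set m]))); rewrite fineK// fin_num_measure.
transitivity (\sum_(i < m) \sum_(j < m) ((i != j)%:R * (x * mu ^+ 2))%:E)%E; last first.
  apply: eq_bigr => i _.
  under [RHS]eq_integral do rewrite natr_sum -sumEFin.
  rewrite ge0_integral_sum//; last first.
    by move=> j; exact/measurable_funTS/(measurable_fun_natrE (mXX i j)).
  apply: eq_bigr => j _; have [_|ij] := eqVneq i j.
    by rewrite mul0r integral0_eq// => w _; rewrite mul0n.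
  under [RHS]eq_integral do rewrite mul1n.
  rewrite integral_mul_indep// ?EX ?Px -?EFinM; first by congr EFin; rewrite mul1r; ring.
  by move=> a b; rewrite -Px; exact: (indepMXX _ _ _ ij).
under [RHS]eq_bigr do rewrite sumEFin -mulr_suml -natr_sum.
rewrite sumEFin -mulr_suml -natr_sum.
have -> : (\sum_(i < m) \sum_(j < m) (i != j) = m * m.-1)%N.
  transitivity (\sum_(i < m) m.-1)%N; last by rewrite sum_nat_const card_ord.
  apply: eq_bigr => i _; rewrite -[in RHS](card_ord m) -(cardC1 i) -sum1_card.
  by rewrite [RHS]big_mkcond; apply: eq_bigr => j _; rewrite inE eq_sym.
by rewrite [X in (_ * (_ * X))%E]Px -EFin_expe -!EFinM; congr EFin; ring.
Qed.

End random_sum.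

(** * From independence of sigma-algebras and families to independence of events *)

Lemma sigma_of_preimage d' (T : Type) (U : measurableType d') (I : Type)
    (J : set I) (Z : I -> T -> U) (i : I) (A : set U) :
  J i -> measurable A -> sigma_of J Z (Z i @^-1` A).
Proof.
move=> Ji mA; apply: sub_sigma_algebra; exists i => //.
by exists A => //; rewrite setTI.
Qed.

Lemma sigma_of_setI d' (T : Type) (U : measurableType d') (I : Type)
    (J : set I) (Z : I -> T -> U) (A B : set T) :
  sigma_of J Z A -> sigma_of J Z B -> sigma_of J Z (A `&` B).
Proof.
move=> sA sB; rewrite (_ : A `&` B =
    setT `\` \bigcup_i bigcup2 (setT `\` A) (setT `\` B) i).
  apply: sigma_algebraCD; apply: sigma_algebra_bigcup => -[|[|i]] /=.
  - exact: sigma_algebraCD.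
  - exact: sigma_algebraCD.
  - exact: sigma_algebra0.
by rewrite bigcup2E -setDIr setDD setTI.
Qed.

Lemma mutually_independent_pair d d' (T : measurableType d)
    (U : measurableType d') (R : realType) (P : probability T R)
    (Z : nat -> T -> U) (i j : nat) (A B : set U) :
  (forall n, mutually_independent P n Z) -> i != j ->
  measurable A -> measurable B ->
  P (Z i @^-1` A `&` Z j @^-1` B) = (P (Z i @^-1` A) * P (Z j @^-1` B))%E.
Proof.
move=> indep ij mA mB.
(* The family is padded with the full set up to the larger of the two indices; the padded factors
   have probability 1. *)
pose F k := if k == i then A else if k == j then B else setT.
have mF k : measurable (F k) by rewrite /F; case: ifP => // _; case: ifP.
pose n := (maxn i j).+1.
have ilt : (i < n)%N by rewrite ltnS leq_maxl.
have jlt : (j < n)%N by rewrite ltnS leq_maxr.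
have ji : j == i = false by rewrite eq_sym (negbTE ij).
have := indep n F mF.
have -> : \bigcap_(k < n) (Z k @^-1` F k) = Z i @^-1` A `&` Z j @^-1` B.
  apply/seteqP; split => w.
    by move=> h; split; [have := h i ilt|have := h j jlt]; rewrite /= /F ?ji !eqxx.
  move=> [Aw Bw] k _ /=; rewrite /F.
  by have [->//|_] := eqVneq k i; have [->|] := eqVneq k j.
move=> ->; rewrite (bigD1 (Ordinal ilt))//= (bigD1 (Ordinal jlt))//=; last first.
  by rewrite -val_eqE /= ji.
rewrite big1 ?mule1 => [|k /andP[ki kj]]; first by rewrite /F ji !eqxx.
move: ki kj; rewrite -!val_eqE /= /F => /negbTE -> /negbTE ->.
by rewrite preimage_setT probability_setT.
Qed.

(** * Overdispersion of the two processes *)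

Lemma mixed_fractional_poisson_moments d (T : measurableType d) (R : realType)
    (P : probability T R) (a1 a2 C1 C2 lambda : R) (M : R -> {RV P >-> nat}) :
  a2 < a1 -> a1 < 1 -> 0 < lambda -> 0 <= C2 -> C1 + C2 = 1 ->
  mixed_fractional_poisson a1 a2 C1 C2 lambda M ->
  forall t : R, 0 < t ->
    (\int[P]_w (M t w)%:R%:E < +oo)%E /\
    ((\int[P]_w (M t w)%:R%:E) ^+ 2 <
      \int[P]_w (M t w * (M t w).-1)%:R%:E)%E.
Proof.
move=> a21 a11 lambda0 C20 C12 [D [Y [N [hD YE hN indNY MNY]]]] t t0.
have YDt w : Y t w = first_passage D t w by exact/YE/ltW.
have Y0 w : 0 <= Y t w by rewrite YDt first_passage_ge0.
have mY : measurable_fun setT (Y t) by exact: measurable_funPT.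
have mM : measurable_fun setT (M t) by exact: measurable_funPT.
have law k : P (M t @^-1` [set k]) = (\int[P]_w (pois k (lambda * Y t w))%:E)%E.
  apply: (poisson_mixture_pmf lambda0 hN mY Y0 mM) => [w|q A B q0 mA mB].
    exact/MNY/ltW.
  by apply: indNY; apply: sigma_of_preimage => //; exact: ltW.
have EM := @poisson_mixture_expectation _ _ _ _ _ _ _ id id (ltW lambda0)
  mY Y0 mM law (@pois_moment1 R).
have EM2 := @poisson_mixture_expectation _ _ _ _ _ _ _
  (fun k => k * k.-1)%N (fun x => x ^+ 2) (ltW lambda0)
  mY Y0 mM law (@pois_factorial_moment2 R).
have EYoo : (\int[P]_w (lambda * Y t w)%:E < +oo)%E.
  under eq_integral do rewrite EFinM.
  rewrite ge0_integralZl//; last 3 first.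
  - exact/measurable_EFinP.
  - by move=> w _; rewrite lee_fin.
  - by rewrite lee_fin ltW.
  by rewrite lte_mul_pinfty// ?lee_fin ?ltW// (first_passage_integrable C12 hD YDt).
split; first by rewrite EM.
rewrite EM EM2; apply: sqr_integral_lt => //.
- exact: measurable_funM.
- by move=> w; rewrite mulr_ge0// ltW.
- move=> c Yc; apply: (first_passage_nonconstant a21 a11 C20 C12 hD t0 YDt (c := lambda^-1 * c)).
  by apply: filterS Yc => w <-; rewrite mulKf// gt_eqF.
Qed.

Theorem mainTheorem3 (R : realType) (d : measure_display)
    (T : measurableType d) (P : probability T R)
    (a1 a2 lambda C1 C2 : R)
    (M : R -> {RV P >-> nat}) (X : nat -> {RV P >-> nat})
    (ha2 : 0 < a2) (ha21 : a2 < a1) (ha1 : a1 < 1) (hlambda : 0 < lambda)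
    (hC1 : 0 <= C1) (hC2 : 0 <= C2) (hC : C1 + C2 = 1)
    (hM : mixed_fractional_poisson a1 a2 C1 C2 lambda M)
    (hXiid : iid X)
    (hXpos : forall i, {ae P, forall w, (0 < X i w)%N})
    (hXmean : ('E_P[fun w => (X 0%N w)%:R] < +oo)%E)
    (hXM : independent_systems P (sigma_of setT X)
                                 (sigma_of [set t | 0 <= t] M)) :
  forall t : R, 0 < t ->
    (0 < 'V_P[fun w => (M t w)%:R] - 'E_P[fun w => (M t w)%:R])%E /\
    (0 < 'V_P[fun w => (compound X M t w)%:R]
         - 'E_P[fun w => (compound X M t w)%:R])%E.
Proof.
move=> t t0.
have [EMoo EM2] := mixed_fractional_poisson_moments ha21 ha1 hlambda hC2 hC hM t0.
have mM : measurable_fun setT (M t) by exact: measurable_funPT.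
have mX i : measurable_fun setT (X i) by exact: measurable_funPT.
split; first exact: overdispersion_criterion.
have EX0oo : (\int[P]_w (X 0%N w)%:R%:E < +oo)%E.
  by move: hXmean; rewrite expectation.unlock.
have [mu EX0] : exists mu, (\int[P]_w (X 0%N w)%:R%:E = mu%:E)%E.
  exists (fine (\int[P]_w (X 0%N w)%:R%:E)%E); rewrite fineK// ge0_fin_numE//.
  by apply: integral_ge0 => w _.
(* Positive integer jumps are at least 1, so [mu >= 1]. Positivity of [mu] keeps the final
   inequality strict after scaling by mu^2. *)
have mu0 : 0 < mu.
  rewrite (lt_le_trans ltr01)// -lee_fin -EX0 -(@probability_setT _ _ _ P).
  rewrite -[leLHS]mul1e -integral_cst//; apply: ae_ge0_le_integral => //.
  - exact: measurable_fun_natrE.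
  - by apply: filterS (hXpos 0%N) => w X0 _; rewrite lee_fin ler1n.
have EX i : (\int[P]_w (X i w)%:R%:E = mu%:E)%E.
  rewrite -EX0 !(@integral_nat_comp _ _ _ P setT _ (fun k => k%:R%:E))//.
  apply: eq_eseriesr => k _; congr (_ * _)%E; rewrite !setTI.
  exact: (hXiid.2 i [set k]).
have indMX m i b : P (M t @^-1` [set m] `&` X i @^-1` [set b]) =
    (P (M t @^-1` [set m]) * P (X i @^-1` [set b]))%E.
  rewrite setIC muleC; apply: hXM; first exact: sigma_of_preimage.
  by apply: sigma_of_preimage => //; exact: ltW.
have indMXX m i j a b : i != j ->
    P (M t @^-1` [set m] `&` X i @^-1` [set a] `&` X j @^-1` [set b]) =
    (P (M t @^-1` [set m]) * P (X i @^-1` [set a]) * P (X j @^-1` [set b]))%E.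
  (* The joint event of [X i] and [X j] lies in the sigma-algebra of [X], so it is separated from
     [M t] as a whole, and pairwise independence factors it. *)
  move=> ij; rewrite -setIA setIC -muleA muleC.
  rewrite -(mutually_independent_pair hXiid.1 ij)//; apply: hXM.
    by apply: sigma_of_setI; exact: sigma_of_preimage.
  by apply: sigma_of_preimage => //; exact: ltW.
apply: overdispersion_criterion.
- exact: (measurable_random_sum R mM mX).
- by rewrite (integral_random_sum mM mX EX indMX) lte_mul_pinfty// lee_fin ltW.
rewrite (integral_random_sum mM mX EX indMX).
apply: lt_le_trans (integral_random_sum_factorial2_ge mM mX EX indMXX).
move: EMoo EM2.
have : (0 <= \int[P]_w (M t w)%:R%:E)%E by exact: integral_ge0.
case: (\int[P]_w (M t w)%:R%:E)%E => [m m0 _|//|//].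
rewrite -!EFin_expe exprMn.
(* A finite second factorial moment of [M t] leaves a real inequality scaled by mu^2; an infinite
   one gives a finite left side below [+oo]. *)
case: (\int[P]_w _)%E => [x| _|//].
  by rewrite -EFinM !lte_fin ltr_pM2l// exprn_gt0.
by rewrite gt0_muley ?ltry// lte_fin exprn_gt0.
Qed.
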